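(* Let $R$ be a unique factorization domain, let $n\geq 2$, let $f,g\in R[X]$ be monic polynomials of degree $n$ with companion matrices $C,D\in M_n(R)$, respectively, and let $m=\deg\gcd(f,g)$. Then $R\langle C,D\rangle=R[C,D]$ is a free $R$-module of rank $n+(n-m)(n-1)$ with basis $$I,C,\dots,C^{n-1},\ D,CD,\dots,C^{n-m-1}D,\ \dots,\ D^{n-1},CD^{n-1},\dots,C^{n-m-1}D^{n-1},$$ that is, the matrices $C^i$ with $0\leq i\leq n-1$ together with the matrices $C^iD^j$ with $0\leq i\leq n-m-1$ and $1\leq j\leq n-1$.
   Context: The companion matrix of a monic polynomial $f=f_0+f_1X+\cdots+f_{n-1}X^{n-1}+X^n\in R[X]$ is the matrix in $M_n(R)$ whose $j$-th column is $e_{j+1}$ for $1\leq j\leq n-1$ and whose last column is $(-f_0,-f_1,\dots,-f_{n-1})^t$, where $e_1,\dots,e_n$ is the canonical basis of the column space $R^n$. $R\langle C,D\rangle$ denotes the (unital) $R$-subalgebra of $M_n(R)$ generated by $C$ and $D$, and $R[C,D]$ denotes the $R$-submodule of $M_n(R)$ spanned by all $C^iD^j$, $i,j\geq 0$. The greatest common divisor is taken in $R[X]$. *)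

(* Defs.v *)
From HB Require Import structures.
From mathcomp Require Import all_boot all_order all_algebra.

Set Implicit Arguments.
Unset Strict Implicit.
Unset Printing Implicit Defensive.

Import GRing.Theory.
Local Open Scope ring_scope.

Definition irreducible_elt (R : idomainType) (p : R) : Prop :=
  [/\ p != 0, p \isn't a GRing.unit &
      forall a b : R, p = a * b -> a \is a GRing.unit \/ b \is a GRing.unit].

Definition associates (R : idomainType) (a b : R) : Prop :=
  exists2 u : R, u \is a GRing.unit & a = u * b.

Definition all_irreducible (R : idomainType) (s : seq R) : Prop :=
  forall p : R, p \in s -> irreducible_elt p.

Definition is_UFD (R : idomainType) : Prop :=
  (forall x : R, x != 0 -> x \isn't a GRing.unit ->
     exists2 s : seq R, all_irreducible s & x = \prod_(p <- s) p) /\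
  (forall s t : seq R, all_irreducible s -> all_irreducible t ->
     \prod_(p <- s) p = \prod_(p <- t) p ->
     size s = size t /\
     exists2 t' : seq R, perm_eq t' t &
       forall i : nat, (i < size s)%N -> associates s`_i t'`_i).

(* Genuine divisibility in R[X]: over an integral domain, [%|] and [gcdp] of
   polydiv only mean divisibility up to a nonzero scalar. *)
Definition divides_poly (R : idomainType) (d f : {poly R}) : Prop :=
  exists q : {poly R}, f = q * d.

Definition is_gcd_poly (R : idomainType) (f g d : {poly R}) : Prop :=
  [/\ divides_poly d f, divides_poly d g &
      forall e : {poly R}, divides_poly e f -> divides_poly e g ->
        divides_poly e d].

(* The transpose of mxpoly's [companionmx], with the size [n] given explicitly
   so that two polynomials of the same degree yield matrices of one type. *)
Definition companion (R : idomainType) (n : nat) (f : {poly R}) : 'M[R]_n :=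
  \matrix_(i < n, j < n)
    if (j : nat) == n.-1 then - f`_i else ((i : nat) == j.+1)%:R.

(* R<C,D>; zero and opposites come from scaling. *)
Inductive gen_subalgebra (R : idomainType) (n : nat) (C D : 'M[R]_n) :
    'M[R]_n -> Prop :=
| gen_subalgebra_l : gen_subalgebra C D C
| gen_subalgebra_r : gen_subalgebra C D D
| gen_subalgebra1 : gen_subalgebra C D 1%:M
| gen_subalgebraD (A B : 'M[R]_n) :
    gen_subalgebra C D A -> gen_subalgebra C D B -> gen_subalgebra C D (A + B)
| gen_subalgebraZ (a : R) (A : 'M[R]_n) :
    gen_subalgebra C D A -> gen_subalgebra C D (a *: A)
| gen_subalgebraM (A B : 'M[R]_n) :
    gen_subalgebra C D A -> gen_subalgebra C D B ->
    gen_subalgebra C D (A *m B).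

(* R[C,D]: the finite linear combinations of the C^i D^j. *)
Definition power_span (R : idomainType) (n : nat) (C D : 'M[R]_n)
    (A : 'M[R]_n) : Prop :=
  exists (s : seq (nat * nat)) (a : nat * nat -> R),
    A = \sum_(k <- s) a k *: (C ^+ k.1 *m D ^+ k.2).

Definition is_basis (R : idomainType) (V : lmodType R) (M : V -> Prop)
    (b : seq V) : Prop :=
  (forall v : V, M v <->
     exists a : 'I_(size b) -> R, v = \sum_(i < size b) a i *: b`_i) /\
  (forall a : 'I_(size b) -> R,
     \sum_(i < size b) a i *: b`_i = 0 -> forall i, a i = 0).

(* The length of a basis is the rank because R is commutative and nontrivial. *)
Definition free_of_rank_with_basis (R : idomainType) (V : lmodType R)
    (M : V -> Prop) (r : nat) (b : seq V) : Prop :=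
  size b = r /\ is_basis M b.

Definition CD_basis (R : idomainType) (n m : nat) (C D : 'M[R]_n) :
    seq 'M[R]_n :=
  [seq C ^+ i | i <- iota 0 n] ++
  [seq C ^+ i *m D ^+ j | j <- iota 1 n.-1, i <- iota 0 (n - m)].

(* Main.v *)
Require Import Defs.
From HB Require Import structures.
From mathcomp Require Import all_boot all_order all_algebra.
From mathcomp Require Import ring zify.

Set Implicit Arguments.
Unset Strict Implicit.
Unset Printing Implicit Defensive.

Import GRing.Theory.
Local Open Scope ring_scope.

(* Identify R^n with R[X]/(f), so that C is multiplication by X, and let I be
   the ideal generated by g.  Since (D^j - C^j) X^i is 0 for i + j < n and -g
   for i + j = n, the matrices D^j - C^j form a triangular system: applying a
   relation to X, X^2, ..., X^(n-1) isolates the coefficients of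
   D^(n-1), D^(n-2), ..., D one at a time, as elements q with f | q g; and
   every endomorphism with image in I is a combination over R[C] of the
   D^j - C^j (0 < j < n) and g(C).  The algebra R[C] + Hom(R^n, I) contains C
   and D, hence R<C,D>, which gives the spanning part.  Writing f = f1 d and
   g = g1 d, coprimality of f1 and g1 (over the fraction field, by a form of
   Gauss' lemma) turns f | q g into f1 | q, so that I is free over R on the
   X^i g with i < deg f1 = n - m. *)

(** * Irreducible elements, primality and Gauss' lemma over a UFD *)

Lemma irreducible_eltMu (R : idomainType) (u p : R) :
  u \is a GRing.unit -> irreducible_elt p -> irreducible_elt (u * p).
Proof.
move=> u_unit [p_neq0 p_nunit p_irr]; split=> [||a b up_eq].
- by rewrite mulf_eq0 negb_or p_neq0 andbT; apply: contraTneq u_unit => ->; rewrite unitr0.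
- by rewrite unitrMr.
- have /p_irr[] : p = (u^-1 * a) * b by rewrite -mulrA -up_eq mulKr.
  + by rewrite unitrMr ?unitrV //; left.
  + by right.
Qed.

Lemma prod_seq_dvd (R : comNzRingType) (q : R) (s : seq R) :
  q \in s -> exists w, \prod_(r <- s) r = w * q.
Proof.
elim: s => //= r s IHs; rewrite in_cons big_cons => /orP[/eqP <-|/IHs[w ->]].
  by exists (\prod_(r <- s) r); rewrite mulrC.
by exists (r * w); rewrite mulrA.
Qed.

(** Concatenated factorizations of [x] and [y] are compared with one of [z * p] that starts with an
    associate of [p]; uniqueness pairs this head with a factor of [x] or of [y]. Zero and units are
    set aside first, since [is_UFD] factors only nonzero nonunits. *)
Lemma ufd_irreducible_prime (R : idomainType) (p x y z : R) :
  is_UFD R -> irreducible_elt p -> x * y = z * p ->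
  (exists w, x = w * p) \/ (exists w, y = w * p).
Proof.
move=> [fact uniq] p_irr xyE.
have [->|x_neq0] := eqVneq x 0; first by left; exists 0; rewrite mul0r.
have [->|y_neq0] := eqVneq y 0; first by right; exists 0; rewrite mul0r.
have [x_unit|x_nunit] := boolP (x \is a GRing.unit).
  by right; exists (x^-1 * z); rewrite -mulrA -xyE mulKr.
have [y_unit|y_nunit] := boolP (y \is a GRing.unit).
  by left; exists (y^-1 * z); rewrite -mulrA -xyE mulrCA mulVr ?mulr1.
have [s s_irr xE] := fact x x_neq0 x_nunit.
have [t t_irr yE] := fact y y_neq0 y_nunit.
have st_irr : all_irreducible (s ++ t).
  by move=> q; rewrite mem_cat => /orP[/s_irr|/t_irr].
have z_neq0 : z != 0.
  by apply: contra_eq_neq xyE => ->; rewrite mul0r mulf_eq0 negb_or x_neq0.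
have [q [v [v_unit pE q_in]]] : exists q v, [/\ v \is a GRing.unit, p = v * q & q \in s ++ t].
  have [r [r0 [r_irr [rE [v v_unit pE]]]]] : exists r r0, all_irreducible (r0 :: r) /\
      \prod_(q <- r0 :: r) q = z * p /\ exists2 v, v \is a GRing.unit & p = v * r0.
    have [z_unit|z_nunit] := boolP (z \is a GRing.unit).
      (* A unit [z] has no factorization to prepend, so it is absorbed into [p]. *)
      exists [::], (z * p); split.
        by move=> q; rewrite inE => /eqP->; apply: irreducible_eltMu.
      by rewrite big_seq1; split=> //; exists z^-1; rewrite ?unitrV ?mulKr.
    have [r r_irr ->] := fact z z_neq0 z_nunit.
    exists r, p; split; first by move=> q; rewrite inE => /orP[/eqP->|/r_irr].
    by rewrite big_cons mulrC; split=> //; exists 1; rewrite ?unitr1 ?mul1r.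
  have [|/= sizeE [t' tP /(_ 0%N isT)[w w_unit /= r0E]]] := uniq _ _ r_irr st_irr.
    by rewrite rE big_cat -xE -yE -xyE.
  exists t'`_0, (v * w); split; first by rewrite unitrM v_unit.
    by rewrite -mulrA -r0E.
  by rewrite -(perm_mem tP) mem_nth // (perm_size tP) -sizeE.
have {pE} qE : q = v^-1 * p by rewrite pE mulKr.
move: q_in; rewrite mem_cat => /orP[/prod_seq_dvd|/prod_seq_dvd] [w].
  by rewrite -xE qE mulrA => ->; left; exists (w / v).
by rewrite -yE qE mulrA => ->; right; exists (w / v).
Qed.

Definition prime_elt (R : nzRingType) (p : R) : Prop :=
  forall x y z : R, x * y = z * p ->
    (exists w, x = w * p) \/ (exists w, y = w * p).

(** Double induction through constant terms: their product is a multiple of [p], hence so is one of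
    them. Removing that term and dividing by ['X] leaves a shorter factor to which induction
    applies. *)
Lemma prime_polyC (R : idomainType) (p : R) : prime_elt p -> prime_elt p%:P.
Proof.
move=> p_prime.
have cancelX (a b r : {poly R}) (w : R) :
    (a * 'X + (w * p)%:P) * b = r * p%:P ->
    a * b = drop_poly 1 (r - w%:P * b) * p%:P.
  move=> E; have {}E : a * b * 'X^1 = (r - w%:P * b) * p%:P.
    by rewrite mulrBl -E polyCM expr1; ring.
  by rewrite -[LHS](@drop_polyMXn_id _ 1) E [in LHS]mulrC (mul_polyC p) drop_polyZ -mul_polyC mulrC.
elim/poly_ind => [|a c IHa] b; first by left; exists 0; rewrite mul0r.
elim/poly_ind: b => [|b e IHb] r E; first by right; exists 0; rewrite mul0r.
have /p_prime[] : c * e = r`_0 * p.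
  by rewrite -coefMC -E coef0M !coefD !coefMX !coefC !add0r.
- move=> [w cE]; rewrite cE in E *.
  have /IHa[[w' ->]|] := cancelX _ _ _ _ E; last by right.
  by left; exists (w' * 'X + w%:P); rewrite polyCM; ring.
- move=> [w eE]; rewrite eE mulrC in E *.
  have := cancelX _ _ _ _ E; rewrite mulrC => /IHb[|[w' ->]]; first by left.
  by right; exists (w' * 'X + w%:P); rewrite polyCM; ring.
Qed.

(* Stripping the irreducible factors of [c] one at a time from either the
   common divisor or both cofactors avoids primitive parts. *)
Lemma ufd_common_divisor (R : idomainType) (c : R) (e a b f g : {poly R}) :
  is_UFD R -> c != 0 -> c *: f = a * e -> c *: g = b * e ->
  exists2 e1 : {poly R}, size e1 = size e & divides_poly e1 f /\ divides_poly e1 g.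
Proof.
move=> ufdR c_neq0 fE gE.
have unit_case (u : R) e' a' b' : u \is a GRing.unit ->
    u *: f = a' * e' -> u *: g = b' * e' -> divides_poly e' f /\ divides_poly e' g.
  move=> u_unit f'E g'E; split; [exists (u^-1 *: a')|exists (u^-1 *: b')].
    by rewrite -scalerAl -f'E scalerA mulVr ?scale1r.
  by rewrite -scalerAl -g'E scalerA mulVr ?scale1r.
have [c_unit|c_nunit] := boolP (c \is a GRing.unit).
  by exists e => //; apply: unit_case c_unit fE gE.
have [s s_irr cE] := ufdR.1 c c_neq0 c_nunit.
rewrite cE in fE gE; elim: s s_irr {c c_neq0 c_nunit cE} e a b fE gE => [|p s IHs] s_irr e a b.
  rewrite big_nil => fE gE; exists e => //.
  exact: unit_case (unitr1 R) fE gE.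
have p_irr : irreducible_elt p by apply: s_irr; rewrite mem_head.
have {}/IHs IHs : all_irreducible s.
  by move=> q qs; apply: s_irr; rewrite in_cons qs orbT.
have p_prime : prime_elt p%:P.
  by apply: prime_polyC => x y z; apply: ufd_irreducible_prime.
have p_neq0 : p%:P != 0 by rewrite polyC_eq0; case: p_irr.
have cancelp := mulfI p_neq0.
rewrite big_cons; move: (\prod_(q <- s) q) IHs => c IHs.
rewrite -!scalerA -!(mul_polyC p) => fE gE.
have divp_e e' : e = e' * p%:P -> exists2 e1 : {poly R},
    size e1 = size e & divides_poly e1 f /\ divides_poly e1 g.
  move=> eE; rewrite eE in fE gE.
  have [||e1 e1E ?] := IHs e' a b.
  - by apply: cancelp; rewrite fE; ring.
  - by apply: cancelp; rewrite gE; ring.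
  by exists e1; rewrite // e1E eE mulrC mul_polyC size_scale //; case: p_irr.
move: (fE) (gE) => /esym; rewrite [p%:P * _]mulrC.
move=> /p_prime[[a' aE]|[e' /divp_e //]].
move=> /esym; rewrite [p%:P * _]mulrC => /p_prime[[b' bE]|[e' /divp_e //]].
apply: (IHs e a' b'); apply: cancelp.
- by rewrite fE aE; ring.
- by rewrite gE bE; ring.
Qed.

(** [gcdp f g] divides [f] and [g] only up to scalars; [ufd_common_divisor] trades it for a genuine
    common divisor of the same size. *)
Lemma ufd_coprimep (R : idomainType) (f g : {poly R}) :
  is_UFD R -> f != 0 ->
  (forall e, divides_poly e f -> divides_poly e g -> size e = 1%N) ->
  coprimep f g.
Proof.
move=> ufdR f_neq0 gcd1; rewrite /coprimep.
have /Pdiv.Idomain.dvdpP[[c a] /= c_neq0 fE] := dvdp_gcdl f g.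
have /Pdiv.Idomain.dvdpP[[c' b] /= c'_neq0 gE] := dvdp_gcdr f g.
have cc'_neq0 : c * c' != 0 by rewrite mulf_neq0.
have [||e1 <- [e1f e1g]] := @ufd_common_divisor _ (c * c') (gcdp f g) (c' *: a) (c *: b) f g ufdR cc'_neq0.
- by rewrite mulrC -scalerA fE scalerAl.
- by rewrite -scalerA gE scalerAl.
- by rewrite gcd1.
Qed.

Lemma ufd_gcd_cofactors (R : idomainType) (f g d : {poly R}) :
  is_UFD R -> f \is monic -> is_gcd_poly f g d ->
  exists f1 g1 d1 : {poly R},
    [/\ f1 \is monic, size d1 = size d, f = f1 * d1, g = g1 * d1 & coprimep f1 g1].
Proof.
move=> ufdR f_monic [[f1 fE] [g1 gE] d_max].
pose u := lead_coef d.
(* The gcd [d] need not be monic, but its leading coefficient divides that of [f], which is 1;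
   rescaling by this unit makes the cofactor of [f] monic. *)
have uu1 : lead_coef f1 * u = 1 by rewrite -lead_coefM -fE; apply/monicP.
have u_unit : u \is a GRing.unit by apply/unitrP; exists (lead_coef f1); split; rewrite ?(mulrC u).
have u_neq0 : u != 0 by apply: contraTneq u_unit => ->; rewrite unitr0.
have d_neq0 : d != 0 by rewrite -lead_coef_eq0.
have f1_neq0 : f1 != 0.
  by rewrite -lead_coef_eq0; apply: contra_eq_neq uu1 => ->; rewrite mul0r eq_sym oner_eq0.
exists (u *: f1), (u *: g1), (u^-1 *: d); split.
- by rewrite monicE lead_coefZ mulrC uu1.
- by rewrite size_scale ?invr_eq0.
- by rewrite -scalerAl -scalerAr scalerA divrr // scale1r.
- by rewrite -scalerAl -scalerAr scalerA divrr // scale1r.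
rewrite coprimepZl ?coprimepZr //; apply: ufd_coprimep => // e [q f1E] [r g1E].
(* A common divisor [e] of the cofactors makes [e * d] a common divisor of [f] and [g], so
   maximality of [d] forces [e] to be a unit. *)
have [w dE] : divides_poly (e * d) d.
  by apply: d_max; [exists q; rewrite fE f1E mulrA|exists r; rewrite gE g1E mulrA].
have we1 : w * e = 1 by apply: (mulIf d_neq0); rewrite -mulrA -dE mul1r.
have : size (w * e) == 1%N by rewrite we1 size_poly1.
have [->|w_neq0] := eqVneq w 0; first by rewrite mul0r size_poly0.
by rewrite size_mul_eq1 => /andP[_ /eqP].
Qed.

(** * Bases indexed by a duplicate-free list *)

Lemma is_basis_map (R : idomainType) (V : lmodType R) (T : eqType) (x0 : T)
    (F : T -> V) (L : seq T) (M : V -> Prop) :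
  uniq L -> (forall v, M v <-> exists c : T -> R, v = \sum_(x <- L) c x *: F x) ->
  (forall c : T -> R, \sum_(x <- L) c x *: F x = 0 -> {in L, forall x, c x = 0}) ->
  is_basis M (map F L).
Proof.
move=> uniqL ME freeL.
have sumE (c : T -> R) : \sum_(x <- L) c x *: F x =
    \sum_(i < size (map F L)) c (nth x0 L i) *: (map F L)`_i.
  rewrite (big_nth x0) -(size_map F L) big_mkord; apply: eq_bigr => i _.
  by rewrite (nth_map x0) // -(size_map F L).
(* Coefficients by position become coefficients by element through [index]; the default 0 is taken
   only outside [L]. *)
pose ext (a : 'I_(size (map F L)) -> R) x := oapp a 0 (insub (index x L)).
have extE a (i : 'I_(size (map F L))) : ext a (nth x0 L i) = a i.
  by rewrite /ext index_uniq -?(size_map F L) // valK.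
have sum_extE a : \sum_(x <- L) ext a x *: F x = \sum_i a i *: (map F L)`_i.
  by rewrite sumE; apply: eq_bigr => i _; rewrite extE.
split=> [v|a a0 i].
  rewrite ME; split=> [[c ->]|[a ->]].
    by exists (fun i => c (nth x0 L i)); rewrite sumE.
  by exists (ext a); rewrite sum_extE.
by rewrite -extE (freeL (ext a)) ?sum_extE // mem_nth // -(size_map F L).
Qed.

(** * Powers of a companion matrix on the canonical basis *)

Section Companion.
Variables (R : idomainType) (N : nat).
Implicit Types (f g p q : {poly R}) (A B T : 'M[R]_N.+1) (v : 'cV[R]_N.+1).

(** Numbered from 0 by plain naturals, so that indices can be added to exponents; [inord] is
    faithful only for [i <= N]. *)
Definition basis_cv (i : nat) : 'cV[R]_N.+1 := delta_mx (inord i) 0.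

Lemma mulmx_basis_eq0 A : (forall i, (i <= N)%N -> A *m basis_cv i = 0) -> A = 0.
Proof.
move=> A0; apply/matrixP => i j; have /colP/(_ i) := A0 j (leq_ord j).
by rewrite -colE !mxE inord_val.
Qed.

Lemma companion_exp_basis f i j :
  (i + j <= N)%N -> companion N.+1 f ^+ j *m basis_cv i = basis_cv (i + j).
Proof.
elim: j => [|j IHj] le_ijN; first by rewrite addn0 expr0 mul1mx.
rewrite exprS -mulmxA IHj ?(leq_trans _ le_ijN) ?leq_add2l // -colE.
rewrite addnS in le_ijN *.
have ltijN : (i + j < N.+1)%N by rewrite ltnW.
by apply/colP => l; rewrite !mxE -val_eqE /= !inordK // ltn_eqF // andbT.
Qed.

Lemma companion_exp_top f i j : (i + j = N.+1)%N -> (0 < j)%N ->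
  companion N.+1 f ^+ j *m basis_cv i = - \col_l f`_l.
Proof.
case: j => // j; rewrite addnS => -[ijN] _.
rewrite exprS -mulmxA companion_exp_basis ?ijN // -colE.
by apply/colP => l; rewrite !mxE inordK // eqxx.
Qed.

(** * The column space as the quotient of R[X] by (f) *)

Section Module.
Variable f : {poly R}.
Hypotheses (f_monic : f \is monic) (size_f : size f = N.+2).
Let C := companion N.+1 f.

(* Identifies [R[X]/(f)] with the column space, [C] acting as multiplication by ['X]. *)
Definition phi p : 'cV[R]_N.+1 := horner_mx C p *m basis_cv 0.

Fact phi_is_linear : linear phi.
Proof. by move=> a p q; rewrite /phi linearP mulmxDl -scalemxAl. Qed.
HB.instance Definition _ := GRing.isLinear.Build R _ _ _ phi phi_is_linear.

Lemma phiM p q : phi (p * q) = horner_mx C p *m phi q.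
Proof. by rewrite /phi rmorphM mulmxA. Qed.

Lemma phiXn i : (i <= N)%N -> phi 'X^i = basis_cv i.
Proof. by move=> leiN; rewrite /phi rmorphXn /= horner_mx_X companion_exp_basis. Qed.

Lemma phi_small p : (size p <= N.+1)%N -> phi p = \col_l p`_l.
Proof.
move=> szp; have {1}-> : p = \poly_(i < N.+1) p`_i.
  by apply/polyP => i; rewrite coef_poly; case: ltnP => // /(leq_trans szp)/(nth_default 0).
rewrite poly_def raddf_sum; apply/colP => l; rewrite summxE mxE (bigD1 l) //= big1.
  by rewrite linearZ /= phiXn ?leq_ord // !mxE inord_val eqxx mulr1 addr0.
move=> i neq_il; rewrite linearZ /= phiXn ?leq_ord // !mxE inord_val.
by rewrite eq_sym (negPf neq_il) mulr0.
Qed.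

Lemma phi_onto v : exists p, v = phi p.
Proof.
exists (\poly_(i < N.+1) v (inord i) 0); rewrite phi_small ?size_poly //.
by apply/colP => l; rewrite mxE coef_poly ltn_ord inord_val.
Qed.

Lemma phi_multiple p : phi (p * f) = 0.
Proof.
(* The leading term sends the first basis vector to minus the column of lower coefficients, which
   cancels the image of the remaining terms. *)
have -> : f = 'X^(N.+1) + take_poly N.+1 f.
  apply/polyP => i; rewrite coefD coef_take_poly coefXn; case: ltngtP => [||->].
  - by rewrite add0r.
  - by move=> ltNi; rewrite addr0 nth_default // size_f.
  - by rewrite addr0; have /monicP := f_monic; rewrite lead_coefE size_f.
rewrite phiM raddfD /= {1}/phi rmorphXn /= horner_mx_X companion_exp_top //.
rewrite phi_small ?size_take_poly // [_ + _](_ : _ = 0) ?mulmx0 //.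
by apply/colP => l; rewrite !mxE coef_take_poly ltn_ord addNr.
Qed.

Lemma phi_small_eq0 p : (size p <= N.+1)%N -> phi p = 0 -> p = 0.
Proof.
move=> szp; rewrite phi_small // => /colP p0; apply/polyP => i; rewrite coef0.
have [ltiN|leNi] := ltnP i N.+1; last by rewrite nth_default // (leq_trans szp).
by have := p0 (Ordinal ltiN); rewrite !mxE.
Qed.

Lemma size_modf p : (size (p %% f)%R <= N.+1)%N.
Proof. by rewrite -ltnS -size_f ltn_modpN0 ?monic_neq0. Qed.

Lemma phi_modf p : phi (p %% f) = phi p.
Proof. by rewrite {2}(Pdiv.IdomainMonic.divp_eq f_monic p) raddfD /= phi_multiple add0r. Qed.

Lemma phi_eq0 p : phi p = 0 -> f %| p.
Proof. by rewrite -phi_modf => /phi_small_eq0 -/(_ (size_modf p))/modp_eq0P. Qed.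

(** The first basis vector is cyclic for [C]: since polynomials in [C] commute, one that kills it
    kills every [phi 'X^i]. *)
Lemma horner_mx_eq0 p : phi p = 0 -> horner_mx C p = 0.
Proof.
move=> p0; apply: mulmx_basis_eq0 => i leiN.
by rewrite -phiXn // -phiM mulrC phiM p0 mulmx0.
Qed.

Lemma horner_modf p : horner_mx C (p %% f) = horner_mx C p.
Proof.
apply/eqP; rewrite -subr_eq0 -raddfB /=; apply/eqP/horner_mx_eq0.
by rewrite raddfB /= phi_modf subrr.
Qed.

(** * The ideal generated by g and the differences of powers of D and C *)

Variable g : {poly R}.
Let D := companion N.+1 g.
Hypotheses (g_monic : g \is monic) (size_g : size g = N.+2).

Definition in_ideal v : Prop := exists q, v = phi (q * g).

Lemma in_idealD v w : in_ideal v -> in_ideal w -> in_ideal (v + w).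
Proof. by move=> [q ->] [r ->]; exists (q + r); rewrite mulrDl raddfD. Qed.

Lemma in_ideal_horner p v : in_ideal v -> in_ideal (horner_mx C p *m v).
Proof. by move=> [q ->]; exists (p * q); rewrite -phiM mulrA. Qed.

Lemma in_ideal0 : in_ideal 0.
Proof. by exists 0; rewrite mul0r raddf0. Qed.

Lemma in_idealZ a v : in_ideal v -> in_ideal (a *: v).
Proof. by move=> [q ->]; exists (a *: q); rewrite -scalerAl linearZ. Qed.

Definition im_in_ideal T : Prop := forall v, in_ideal (T *m v).

Lemma im_in_ideal_basis T : (forall i, (i <= N)%N -> in_ideal (T *m basis_cv i)) -> im_in_ideal T.
Proof.
move=> T_e v; have -> : v = \sum_i v i 0 *: basis_cv i.
  apply/colP => l; rewrite summxE (bigD1 l) //= big1 => [|i neq_il].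
    by rewrite !mxE inord_val eqxx mulr1 addr0.
  by rewrite !mxE inord_val eq_sym (negPf neq_il) mulr0.
rewrite mulmx_sumr; elim/big_ind: _ => [||i _]; [exact: in_ideal0|exact: in_idealD|].
by rewrite -scalemxAr; apply/in_idealZ/T_e/leq_ord.
Qed.

Lemma im_in_idealD S T : im_in_ideal S -> im_in_ideal T -> im_in_ideal (S + T).
Proof. by move=> IS IT v; rewrite mulmxDl; apply: in_idealD. Qed.

Lemma im_in_idealZ a T : im_in_ideal T -> im_in_ideal (a *: T).
Proof. by move=> IT v; rewrite -scalemxAl; apply: in_idealZ. Qed.

Lemma im_in_idealMl S T : im_in_ideal S -> im_in_ideal (S *m T).
Proof. by move=> IS v; rewrite -mulmxA. Qed.

Lemma im_in_idealMr p T : im_in_ideal T -> im_in_ideal (horner_mx C p *m T).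
Proof. by move=> IT v; rewrite -mulmxA; apply: in_ideal_horner. Qed.

Lemma companion_last_col_diff : - \col_l g`_l - - \col_l f`_l = - phi g.
Proof.
(* [g] is too long for [phi_small]; subtracting [f] cancels the leading term without changing the
   class. *)
have -> : phi g = phi (g - f) by rewrite raddfB /= -[X in _ - phi X]mul1r phi_multiple subr0.
rewrite phi_small.
  by apply/colP => l; rewrite !mxE coefB opprB opprK addrC.
apply/leq_sizeP => i; rewrite leq_eqVlt coefB => /orP[/eqP<-|ltNi].
  have /monicP := f_monic; have /monicP := g_monic.
  by rewrite !lead_coefE size_f size_g /= => -> ->; rewrite subrr.
by rewrite !nth_default ?size_f ?size_g ?subrr.
Qed.

Lemma diff_exp_basis i j : (i + j <= N)%N -> (D ^+ j - C ^+ j) *m basis_cv i = 0.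
Proof. by move=> leijN; rewrite mulmxBl !companion_exp_basis ?subrr. Qed.

Lemma diff_exp_top i j : (i + j = N.+1)%N -> (0 < j)%N ->
  (D ^+ j - C ^+ j) *m basis_cv i = - phi g.
Proof. by move=> ijN j_gt0; rewrite mulmxBl !companion_exp_top // companion_last_col_diff. Qed.

Lemma diff_in_ideal : im_in_ideal (D - C).
Proof.
apply: im_in_ideal_basis => i; rewrite leq_eqVlt -[D]expr1 -[C]expr1 => /orP[/eqP->|ltiN].
  by rewrite diff_exp_top ?addn1 //; exists (-1); rewrite mulN1r raddfN.
by rewrite diff_exp_basis ?addn1 //; apply: in_ideal0.
Qed.

Lemma diff_exp_in_ideal j : im_in_ideal (D ^+ j - C ^+ j).
Proof.
elim: j => [|j IHj]; first by move=> v; rewrite subrr mul0mx; apply: in_ideal0.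
(* The first summand has image in that of [D - C]; the second stays in the ideal because the ideal
   is stable under [C]. *)
have -> : D ^+ j.+1 - C ^+ j.+1 = (D - C) *m D ^+ j + C *m (D ^+ j - C ^+ j).
  by rewrite !mulmxE !exprS mulrBl mulrBr addrA subrK.
apply: im_in_idealD; first by apply: im_in_idealMl; apply: diff_in_ideal.
by have := im_in_idealMr 'X IHj; rewrite horner_mx_X.
Qed.

(* Membership in [R[C] + Hom(R^n, I)], where [I] is the ideal [(g)] of [R[X]/(f)]:
   this set is an algebra because [I] is stable under [C]. *)
Definition in_poly_plus_hom A : Prop := exists p, im_in_ideal (A - horner_mx C p).

Lemma in_poly_plus_homM A B : in_poly_plus_hom A -> in_poly_plus_hom B -> in_poly_plus_hom (A *m B).
Proof.
move=> [p Ap] [q Bq]; exists (p * q).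
(* The decomposition is AB - p(C)q(C) = (A - p(C))B + p(C)(B - q(C)). *)
rewrite -[X in X *m _](subrK (horner_mx C p)) -[B in _ *m B](subrK (horner_mx C q)).
rewrite rmorphM /= mulmxDl -addrA [in X in _ + (X - _)]mulmxDr addrK.
by apply: im_in_idealD; [apply: im_in_idealMl|apply: im_in_idealMr].
Qed.

Lemma gen_subalgebra_poly_plus_hom A : gen_subalgebra C D A -> in_poly_plus_hom A.
Proof.
have S_horner p : in_poly_plus_hom (horner_mx C p).
  by exists p => v; rewrite subrr mul0mx; apply: in_ideal0.
elim=> {A} [||| A B _ [p Ap] _ [q Bq] | a A _ [p Ap] | A B _ SA _ SB].
- by rewrite -(horner_mx_X C).
- by exists 'X; rewrite horner_mx_X; apply: diff_in_ideal.
- by rewrite -(horner_mx_C C 1).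
- by exists (p + q); rewrite raddfD /= opprD addrACA; apply: im_in_idealD.
- by exists (a *: p); rewrite linearZ /= -scalerBr; apply: im_in_idealZ.
- exact: in_poly_plus_homM.
Qed.

Lemma gen_subalgebra_exp A j : gen_subalgebra C D A -> gen_subalgebra C D (A ^+ j).
Proof.
move=> CD_A; elim: j => [|j IHj]; first by rewrite expr0; apply: gen_subalgebra1.
by rewrite exprS; apply: gen_subalgebraM.
Qed.

(** * Coprime cofactors and the spanning property *)

Variables (f1 g1 d1 : {poly R}).
Hypotheses (f1_monic : f1 \is monic) (fE : f = f1 * d1) (gE : g = g1 * d1).
Hypothesis (coprime_fg : coprimep f1 g1).
Let k := (size f1).-1.

Lemma in_ideal_small v : in_ideal v -> exists2 q : {poly R}, (size q <= k)%N & v = phi (q * g).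
Proof.
move=> [q ->]; exists (q %% f1).
  by rewrite -ltnS prednK ?ltn_modpN0 ?monic_neq0 // size_poly_gt0 monic_neq0.
rewrite {1}(Pdiv.IdomainMonic.divp_eq f1_monic q) mulrDl raddfD /=.
(* Since f1 g = g1 f vanishes modulo [f], only [q] modulo [f1] matters. *)
rewrite (_ : _ * f1 * g = q %/ f1 * g1 * f) ?phi_multiple ?add0r //.
by rewrite fE gE; ring.
Qed.

Lemma phi_mulg_eq0 q : (size q <= k)%N -> phi (q * g) = 0 -> q = 0.
Proof.
move=> szq /phi_eq0 /(Pdiv.IdomainMonic.dvdpP f_monic)[w E].
have d1_neq0 : d1 != 0.
  by have := monic_neq0 f_monic; apply: contra_neq => d10; rewrite fE d10 mulr0.
(* Cancel [d1] in f | q g; as [f] and [f1] are monic, [%|] is genuine divisibility here. *)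
have : f1 %| q * g1.
  apply/(Pdiv.IdomainMonic.dvdpP f1_monic); exists w; apply: (mulIf d1_neq0).
  by rewrite -!mulrA -fE -gE.
rewrite Gauss_dvdpl // => f1_q; apply/eqP; apply: contraTT szq => q_neq0.
by rewrite -ltnNge prednK ?dvdp_leq // size_poly_gt0 monic_neq0.
Qed.

(** The span of the claimed basis, with the coefficients of the [C ^+ i *m D ^+ j] for fixed [j]
    packed into one polynomial; [k] equals n - m. *)
Definition poly_span A : Prop := exists (p : {poly R}) (q : nat -> {poly R}),
  [/\ (size p <= N.+1)%N, forall j, (size (q j) <= k)%N &
      A = horner_mx C p + \sum_(1 <= j < N.+1) horner_mx C (q j) *m D ^+ j].

Lemma poly_spanD A B : poly_span A -> poly_span B -> poly_span (A + B).
Proof.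
move=> [p [q [szp szq ->]]] [p' [q' [szp' szq' ->]]].
exists (p + p'), (fun j => q j + q' j); split.
- by rewrite (leq_trans (size_polyD _ _)) // geq_max szp.
- by move=> j; rewrite (leq_trans (size_polyD _ _)) // geq_max szq szq'.
- rewrite raddfD addrACA -big_split; congr (_ + _).
  by apply: eq_bigr => j _; rewrite raddfD mulmxDl.
Qed.

Lemma poly_span_horner p : poly_span (horner_mx C p).
Proof.
exists (p %% f), (fun=> 0); split; [exact: size_modf|by move=> j; rewrite size_poly0|].
by rewrite horner_modf big1 ?addr0 // => j _; rewrite raddf0 mul0mx.
Qed.

Lemma poly_span_horner_exp q j : (0 < j <= N)%N -> (size q <= k)%N ->
  poly_span (horner_mx C q *m D ^+ j).
Proof.
move=> /andP[j_gt0 lejN] szq; exists 0, (fun i => if i == j then q else 0); split.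
- by rewrite size_poly0.
- by move=> i; case: ifP; rewrite ?size_poly0.
rewrite raddf0 add0r (bigD1_seq j) ?mem_index_iota ?j_gt0 ?iota_uniq //= eqxx.
by rewrite big1 ?addr0 // => i /negPf->; rewrite raddf0 mul0mx.
Qed.

(* By induction on the number of basis vectors that [T] may not kill: a
   multiple of [D ^+ l - C ^+ l] corrects the first of them. *)
Lemma im_in_ideal_poly_span T l : (l <= N.+1)%N -> im_in_ideal T ->
  (forall i, (i + l < N.+1)%N -> T *m basis_cv i = 0) -> poly_span T.
Proof.
elim: l T => [|l IHl] T lelN IT T0.
  have -> : T = horner_mx C 0.
    by rewrite raddf0; apply: mulmx_basis_eq0 => i leiN; rewrite T0 ?addn0.
  exact: poly_span_horner.
(* The first basis vector that [T] may not kill has index [N - l]. *)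
have [q szq TE] := in_ideal_small (IT (basis_cv (N - l))).
suff [U [IU USpan U0 Ul]] : exists U, [/\ im_in_ideal U, poly_span U,
    forall i, (i + l < N)%N -> U *m basis_cv i = 0 & U *m basis_cv (N - l) = phi (q * g)].
  rewrite -(subrK U T); apply: poly_spanD => //; apply: IHl; first exact: ltnW.
    by rewrite -scaleN1r; apply: im_in_idealD => //; apply: im_in_idealZ.
  move=> i; rewrite ltnS leq_eqVlt mulmxBl => /orP[/eqP iE|lt_ilN]; last first.
    by rewrite T0 ?addnS ?ltnS // U0 // subrr.
  have -> : i = (N - l)%N by rewrite -iE addnK.
  by rewrite TE Ul subrr.
move: lelN; rewrite ltnS leq_eqVlt => /orP[/eqP lN|ltlN].
  (* For [l = N] the vector to correct is [basis_cv 0], and the difference of powers would have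
     exponent [N.+1], beyond the range of the span. A polynomial in [C] does the job instead. *)
  exists (horner_mx C (q * g)); split.
  - move=> v; have [p ->] := phi_onto v.
    by rewrite -phiM mulrAC; exists (q * p).
  - exact: poly_span_horner.
  - by move=> i; rewrite lN ltnNge leq_addl.
  - by rewrite lN subnn.
have CDl : poly_span (horner_mx C (- q) *m (D ^+ l.+1 - C ^+ l.+1)).
  rewrite mulmxBr; apply: poly_spanD.
    by apply: poly_span_horner_exp; rewrite ?size_polyN.
  have -> : C ^+ l.+1 = horner_mx C 'X^(l.+1) by rewrite rmorphXn /= horner_mx_X.
  by rewrite mulmxE -rmorphM -raddfN; apply: poly_span_horner.
(* The sign compensates for the value [- phi g] in [diff_exp_top]. *)
exists (horner_mx C (- q) *m (D ^+ l.+1 - C ^+ l.+1)); split=> //.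
- apply: im_in_idealMr; exact: diff_exp_in_ideal.
- by move=> i ltilN; rewrite -mulmxA diff_exp_basis ?mulmx0 // addnS.
- rewrite -mulmxA diff_exp_top ?addnS ?subnK // 1?ltnW //.
  by rewrite mulmxN -phiM mulNr raddfN opprK.
Qed.

Lemma in_poly_plus_hom_poly_span A : in_poly_plus_hom A -> poly_span A.
Proof.
move=> [p IA]; rewrite -(subrK (horner_mx C p) A); apply: poly_spanD; last exact: poly_span_horner.
by apply: (@im_in_ideal_poly_span _ N.+1) => // i; rewrite ltnNge leq_addl.
Qed.

(** * Linear independence *)

Lemma poly_span_free p (q : nat -> {poly R}) : (size p <= N.+1)%N -> (forall j, (size (q j) <= k)%N) ->
  horner_mx C p + \sum_(1 <= j < N.+1) horner_mx C (q j) *m D ^+ j = 0 ->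
  p = 0 /\ forall j, (0 < j <= N)%N -> q j = 0.
Proof.
move=> szp szq sum0.
(* [r] is the relation with [D] replaced by [C]. All differences [D ^+ j - C ^+ j] with [j <= N]
   kill [basis_cv 0], so [phi r = 0] and hence [r] vanishes at [C]. *)
pose r := p + \sum_(1 <= j < N.+1) q j * 'X^j.
have diffE : \sum_(1 <= j < N.+1) horner_mx C (q j) *m (D ^+ j - C ^+ j) = - horner_mx C r.
  apply/eqP; rewrite -addr_eq0 -[X in _ == X]sum0 raddfD raddf_sum /= addrCA -big_split /=; apply/eqP.
  congr (_ + _); apply: eq_bigr => j _.
  by rewrite rmorphM rmorphXn /= horner_mx_X mulmxBr subrK.
have r0 : phi r = 0.
  apply: oppr_inj; rewrite /phi -mulNmx -diffE mulmx_suml oppr0 big_nat big1 // => j /andP[_ ltjN].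
  by rewrite -mulmxA diff_exp_basis ?mulmx0.
rewrite (horner_mx_eq0 r0) oppr0 in diffE.
(* Descending induction on [j]: at [basis_cv (N.+1 - j)] the terms of lower exponent vanish, and
   those of higher exponent already have zero coefficient. *)
have q0 l j : (N - j < l)%N -> (0 < j <= N)%N -> q j = 0.
  elim: l j => // l IHl j ltNjl /andP[j_gt0 lejN].
  have := congr1 (mulmx^~ (basis_cv (N.+1 - j))) diffE; rewrite /= mul0mx mulmx_suml.
  rewrite (bigD1_seq j) ?mem_index_iota ?j_gt0 ?iota_uniq //=.
  rewrite big_nat_cond big1 => [|i /andP[/andP[i_gt0 leiN]]].
    rewrite -mulmxA diff_exp_top ?subnK 1?leqW // addr0 mulmxN -phiM => /eqP.
    by rewrite oppr_eq0 => /eqP; apply: phi_mulg_eq0.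
  rewrite neq_ltn -mulmxA => /orP[ltij|ltji]; first by rewrite diff_exp_basis ?mulmx0 //; lia.
  by rewrite IHl ?raddf0 ?mul0mx //; lia.
have {}q0 j : (0 < j <= N)%N -> q j = 0 by apply: q0 (ltnSn _).
split=> //; apply: phi_small_eq0 => //; rewrite -[p]addr0.
by rewrite -r0 /r big_nat big1 ?addr0 // => j /q0 ->; rewrite mul0r.
Qed.

(** * From polynomial coefficients to the list of basis matrices *)

Let F (x : nat * nat) := C ^+ x.1 *m D ^+ x.2.

(** Pairs of exponents are visibly distinct, whereas the distinctness of the matrices would itself
    require freeness. *)
Definition basis_exponents : seq (nat * nat) :=
  [seq (i, 0%N) | i <- iota 0 N.+1] ++ [seq (i, j) | j <- iota 1 N, i <- iota 0 k].

Lemma basis_exponents_uniq : uniq basis_exponents.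
Proof.
rewrite cat_uniq map_inj_uniq ?iota_uniq => [|i j [] //]; rewrite andTb.
rewrite allpairs_uniq ?iota_uniq ?andbT // => [|[i j] [i' j'] _ _ /= [-> ->] //].
apply/hasPn => x /allpairsP[[j i] []]; rewrite mem_iota => /andP[j_gt0 _] _ ->.
by apply: contraTN j_gt0 => /mapP[l _ [_ ->]].
Qed.

Lemma horner_poly l (c : nat -> R) :
  horner_mx C (\poly_(i < l) c i) = \sum_(i <- iota 0 l) c i *: C ^+ i.
Proof.
rewrite poly_def raddf_sum /= -[l in iota 0 l]subn0 -/(index_iota 0 l) big_mkord.
by apply: eq_bigr => i _; rewrite linearZ /= rmorphXn /= horner_mx_X.
Qed.

Lemma sum_basis_exponents (c : nat * nat -> R) :
  \sum_(x <- basis_exponents) c x *: F x =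
  horner_mx C (\poly_(i < N.+1) c (i, 0%N)) +
  \sum_(1 <= j < N.+1) horner_mx C (\poly_(i < k) c (i, j)) *m D ^+ j.
Proof.
rewrite big_cat big_map big_allpairs_dep horner_poly; congr (_ + _).
  by apply: eq_bigr => i _; rewrite /F expr0 mulmx1.
rewrite /index_iota subn1; apply: eq_bigr => j _.
by rewrite horner_poly mulmx_suml; apply: eq_bigr => i _; rewrite scalemxAl.
Qed.

Lemma gen_subalgebra_basis_exponents A : gen_subalgebra C D A ->
  exists c : nat * nat -> R, A = \sum_(x <- basis_exponents) c x *: F x.
Proof.
move=> /gen_subalgebra_poly_plus_hom/in_poly_plus_hom_poly_span[p [q [szp szq ->]]].
have trunc l (r : {poly R}) : (size r <= l)%N -> \poly_(i < l) r`_i = r.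
  move=> szr; apply/polyP => i; rewrite coef_poly; case: ltnP => // leli.
  by rewrite nth_default // (leq_trans szr).
exists (fun x => if x.2 == 0%N then p`_x.1 else (q x.2)`_x.1).
rewrite sum_basis_exponents /= trunc //; congr (_ + _).
by rewrite big_nat [RHS]big_nat; apply: eq_bigr => -[|j] //= _; rewrite trunc.
Qed.

Lemma basis_exponents_free (c : nat * nat -> R) :
  \sum_(x <- basis_exponents) c x *: F x = 0 -> {in basis_exponents, forall x, c x = 0}.
Proof.
rewrite sum_basis_exponents => /poly_span_free[|j|p0 q0 x]; rewrite ?size_poly //.
rewrite mem_cat => /orP[/mapP[i]|/allpairsP[[j i] /=]].
  rewrite mem_iota => /= ltiN ->.
  by have := congr1 (fun p : {poly R} => p`_i) p0; rewrite coef_poly coef0 ltiN.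
rewrite !mem_iota add1n ltnS add0n /= => -[jN ltik ->].
by have := congr1 (fun p : {poly R} => p`_i) (q0 j jN); rewrite coef_poly coef0 ltik.
Qed.

Lemma power_span_gen A : power_span C D A -> gen_subalgebra C D A.
Proof.
move=> [s [a ->]]; elim/big_ind: _ => [||x _].
- by rewrite -(scale0r 1%:M); apply/gen_subalgebraZ/gen_subalgebra1.
- exact: gen_subalgebraD.
- by apply/gen_subalgebraZ/gen_subalgebraM; apply: gen_subalgebra_exp;
    [apply: gen_subalgebra_l|apply: gen_subalgebra_r].
Qed.

Lemma gen_subalgebra_power_span A : gen_subalgebra C D A <-> power_span C D A.
Proof.
split; last exact: power_span_gen.
by move=> /gen_subalgebra_basis_exponents[c cE]; exists basis_exponents, c.
Qed.

Lemma CD_basisP m : (N.+1 - m)%N = k ->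
  free_of_rank_with_basis (gen_subalgebra C D) (N.+1 + k * N) (CD_basis m C D).
Proof.
move=> mk; split; first by rewrite size_cat size_allpairs size_map !size_iota mk mulnC.
have -> : CD_basis m C D = map F basis_exponents.
  rewrite /CD_basis mk map_cat map_allpairs -map_comp; congr (_ ++ _).
  by apply: eq_map => i; rewrite /= /F expr0 mulmx1.
apply: (is_basis_map (0%N, 0%N) basis_exponents_uniq); last exact: basis_exponents_free.
move=> A; split=> [/gen_subalgebra_basis_exponents //|[c ->]].
by apply: power_span_gen; exists basis_exponents, c.
Qed.
End Module.
End Companion.

(** * The gcd cofactors put into the module computation *)

Theorem theorem9p2 (R : idomainType) (hR : is_UFD R)
    (n : nat) (hn : (2 <= n)%N)
    (f g : {poly R}) (hf : f \is monic) (hg : g \is monic)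
    (hfn : size f = n.+1) (hgn : size g = n.+1)
    (d : {poly R}) (hd : is_gcd_poly f g d) :
  let C := companion n f in
  let D := companion n g in
  let m := (size d).-1 in
  (forall A : 'M[R]_n, gen_subalgebra C D A <-> power_span C D A) /\
  free_of_rank_with_basis (gen_subalgebra C D)
    (n + (n - m) * (n - 1))%N (CD_basis m C D).
Proof.
move=> C D m.
have [f1 [g1 [d1 [f1_monic szd fE gE coprime_fg]]]] := ufd_gcd_cofactors hR hf hd.
case: n hn hfn hgn @C @D => // N _ size_f size_g C D.
(* Degrees add in f = f1 d1, and [d1] has the size of [d]. *)
have mk : (N.+1 - m)%N = (size f1).-1.
  have d1_neq0 : d1 != 0 by have := monic_neq0 hf; apply: contra_neq => d10; rewrite fE d10 mulr0.
  have := size_f; rewrite fE size_monicM // szd /m.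
  have : (0 < size d)%N by rewrite -szd size_poly_gt0.
  have : (0 < size f1)%N by rewrite size_poly_gt0 monic_neq0.
  by lia.
split=> [A|]; first exact: (gen_subalgebra_power_span hf size_f hg size_g f1_monic fE gE).
rewrite mk subn1 /=; exact: (CD_basisP hf size_f hg size_g f1_monic fE gE coprime_fg mk).
Qed.
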